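(* Let $a<b$ be real numbers, let $f\in C^\infty([a,b])$ be real-valued, put $F_n=\max_{x\in[a,b]}|f^{(n)}(x)|$ for $n\in\mathbb{N}$, and let $C^F([a,b])$ be the corresponding Denjoy-Carleman class defined by the sequence $\{F_n\}_n$. Let $\{d_n\}_{n\in\mathbb{N}}$ be an increasing divergent sequence of positive integers. Assume that there exists $K>0$ such that $$F_{d_n}\le K^{d_n+1}\,d_n^{\,d_n}\qquad\text{for every } n\in\mathbb{N}.$$ Then $f$ is identically zero on $[a,b]$ whenever $f$ vanishes of infinite order at a point of $[a,b]$.
   Context: $\mathbb{N}$ denotes the set of non-negative integers. $C^\infty([a,b])$ is the set of smooth functions on the closed interval $[a,b]$. A function $f$ vanishes of infinite order at $x_0\in[a,b]$ if $f^{(n)}(x_0)=0$ for all $n\in\mathbb{N}$. For a sequence $F=\{F_n\}_{n\in\mathbb{N}}$, the Denjoy-Carleman class is $$C^F([a,b])=\{g\in C^\infty([a,b]) : \exists K>0 \text{ such that } |g^{(n)}(x)|\le K^{n+1}F_n \text{ for all } x\in[a,b],\ n=0,1,2,\ldots\}.$$ *)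

(* Defs.v *)
(* MathComp-Analysis. *)
From HB Require Import structures.
From mathcomp Require Import all_boot all_order all_algebra.
From mathcomp Require Import all_classical all_reals all_analysis.

Set Implicit Arguments.
Unset Strict Implicit.
Unset Printing Implicit Defensive.

Import Order.TTheory GRing.Theory Num.Theory.
Import numFieldNormedType.Exports.
Local Open Scope classical_set_scope.
Local Open Scope ring_scope.

(* Functions on [a, b] are represented by total functions R -> R whose values
   outside [a, b] are irrelevant: below, the variable y ranges over [a, b]
   minus x, so derivatives are one-sided at a and at b. *)
Definition diff_quotient_on (R : realType) (a b : R) (f : R -> R) (x : R) :
    set_system R :=
  ((f y - f x) / (y - x)) @[y --> within `[a, b] x^'].

Definition derive_on (R : realType) (a b : R) (f : R -> R) : R -> R :=
  fun x => lim (diff_quotient_on a b f x).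

Definition nderive_on (R : realType) (a b : R) (n : nat) (f : R -> R) : R -> R :=
  iter n (derive_on a b) f.

Definition smooth_on (R : realType) (a b : R) (f : R -> R) : Prop :=
  forall n x, x \in `[a, b] -> cvg (diff_quotient_on a b (nderive_on a b n f) x).

Definition is_max (R : realType) (S : set R) (m : R) : Prop := S m /\ ubound S m.

Definition vanishes_infinite_order (R : realType) (a b : R) (f : R -> R)
    (x0 : R) : Prop :=
  forall n, nderive_on a b n f x0 = 0.

(* Main.v *)
(* If f vanishes of infinite order at x0, Taylor's formula at order d = d_n gives
   |f(x)| <= F_d |x - x0|^d / d! <= K (K e |x - x0|)^d, because d^d <= e^d d!.
   Letting n go to infinity, f = 0 wherever |x - x0| < 1 / (K e). All derivatives
   then vanish there too, and since this radius does not depend on x0, finitely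
   many such steps cover [a, b]. *)
Require Import Defs.
From HB Require Import structures.
From mathcomp Require Import all_boot all_order all_algebra.
From mathcomp Require Import all_classical all_reals all_analysis.
From mathcomp Require Import lra.

Set Implicit Arguments.
Unset Strict Implicit.
Unset Printing Implicit Defensive.

Import Order.TTheory GRing.Theory Num.Theory.
Import numFieldNormedType.Exports.
Local Open Scope classical_set_scope.
Local Open Scope ring_scope.

Lemma diff_quotient_onP (R : realType) (a b : R) (f : R -> R) (x l : R) :
  diff_quotient_on a b f x --> l <->
  forall e, 0 < e -> exists2 r, 0 < r & forall y, y \in `[a, b] -> y != x ->
    `|x - y| < r -> `|l - (f y - f x) / (y - x)| < e.
Proof.
rewrite /diff_quotient_on; split=> [/cvgrPdist_lt fl e e0|fl].
  have := fl e e0; rewrite near_withinE => -[r /= r0 rP].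
  by exists r => // y yab yx xyr; apply: (rP y).
apply/cvgrPdist_lt => e /fl[r r0 rP]; rewrite near_withinE.
by exists r => //= y xyr yx yab; apply: rP.
Qed.

(** Since [a < b], every point of the interval is approached from the right or from the left inside
    it. Properness makes limits unique, so that the [lim] in [derive_on] can be computed. *)
Lemma itv_dnbhs_proper (R : realType) (a b x : R) : a < b -> x \in `[a, b] ->
  ProperFilter (within `[a, b] x^').
Proof.
move=> ab; rewrite in_itv/= => /andP[ax xb]; apply: Build_ProperFilter => -[r /= r0 rP].
have [xb'|bx] := ltP x b.
  pose s := Num.min (r / 2) (b - x).
  have s0 : 0 < s by rewrite lt_min subr_gt0 xb' divr_gt0.
  have sr : s <= r / 2 by rewrite ge_min lexx.
  have sb : s <= b - x by rewrite ge_min lexx orbT.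
  apply: (rP (x + s)) => /=.
  - by rewrite opprD addNKr normrN gtr0_norm//; lra.
  - by rewrite -subr_eq0 addrAC subrr add0r gt_eqF.
  - by rewrite in_itv/=; apply/andP; split; lra.
pose s := Num.min (r / 2) (x - a).
have s0 : 0 < s by rewrite lt_min subr_gt0 (lt_le_trans ab)// divr_gt0.
have sr : s <= r / 2 by rewrite ge_min lexx.
have sb : s <= x - a by rewrite ge_min lexx orbT.
apply: (rP (x - s)) => /=.
- by rewrite opprB addrCA subrr addr0 gtr0_norm//; lra.
- by rewrite -subr_eq0 addrAC subrr add0r oppr_eq0 gt_eqF.
- by rewrite in_itv/=; apply/andP; split; lra.
Qed.

Lemma derive_on_locally0 (R : realType) (a b : R) (f : R -> R) (x r : R) :
  a < b -> x \in `[a, b] -> 0 < r ->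
  (forall y, y \in `[a, b] -> `|x - y| < r -> f y = 0) ->
  derive_on a b f x = 0.
Proof.
move=> ab xab r0 f0; rewrite /derive_on.
have pf := itv_dnbhs_proper ab xab.
apply: cvg_lim; first exact: Rhausdorff.
apply/diff_quotient_onP => e e0; exists r => // y yab _ xyr.
by rewrite !f0 ?subrr ?normr0 ?mul0r ?subrr ?normr0.
Qed.

(** Increments smaller than [x - a] and [b - x] stay in the interval, so restricting to it changes
    nothing at an interior point. This gives access to Rolle's theorem. *)
Lemma is_derive_interior (R : realType) (a b : R) (f : R -> R) (x : R) :
  x \in `]a, b[ -> cvg (diff_quotient_on a b f x) ->
  is_derive x 1 f (derive_on a b f x).
Proof.
rewrite in_itv/= => /andP[ax xb] /diff_quotient_onP fx.
suff fl : h^-1 *: ((f \o shift x) (h *: 1) - f x) @[h --> 0^'] -->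
    derive_on a b f x.
  by apply: DeriveDef; [apply/cvg_ex; exists (derive_on a b f x)|exact: cvg_lim].
apply/cvgrPdist_lt => e /fx[r r0 rP]; rewrite near_withinE.
exists (Num.min r (Num.min (x - a) (b - x))) => /=.
  by rewrite !lt_min r0 !subr_gt0 ax.
move=> h; rewrite /= sub0r normrN !lt_min => /and3P[hr ha hb] h0.
have hx : h + x - x = h by rewrite addrK.
rewrite (_ : _ *: _ = (f (h + x) - f x) / (h + x - x)); last first.
  by rewrite hx mulrC/=; congr (_ * (f (_ + _) - _)); rewrite /GRing.scale/= mulr1.
apply: rP.
- by rewrite in_itv/=; apply/andP; move: ha hb; rewrite !ltr_norml; split; lra.
- by rewrite -subr_eq0 hx.
- by rewrite distrC hx.
Qed.

(** Near [x] the quotient is within 1 of its limit [l], hence [|f y - f x| <= (|l| + 1) |y - x|].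
    The endpoints are covered as well. *)
Lemma within_continuous_diff_quotient (R : realType) (a b : R) (f : R -> R) :
  (forall x, x \in `[a, b] -> cvg (diff_quotient_on a b f x)) ->
  {within `[a, b], continuous f}.
Proof.
move=> fab; apply/subspace_continuousP => x /= xab.
have /diff_quotient_onP := fab x xab; set l := lim _ => fx.
have [r r0 rP] := fx 1 ltr01.
apply/cvgrPdist_lt => e e0; rewrite near_withinE.
have l1 : 0 < `|l| + 1 by rewrite ltr_wpDl.
exists (Num.min r (e / (`|l| + 1))) => /=; first by rewrite lt_min r0 divr_gt0.
move=> y; rewrite /= lt_min => /andP[xyr xye] yab.
have [->|yx] := eqVneq y x; first by rewrite subrr normr0.
have yx0 : y - x != 0 by rewrite subr_eq0.
have ql : `|(f y - f x) / (y - x)| < `|l| + 1.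
  have := rP y yab yx xyr; have := ler_distD l ((f y - f x) / (y - x)) 0.
  by rewrite !subr0 distrC; lra.
rewrite distrC -(divfK yx0 (f y - f x)) normrM.
rewrite ltr_pdivlMr// distrC in xye.
rewrite (le_lt_trans _ xye)// mulrC ler_wpM2l//.
exact: ltW.
Qed.

(* Rolle's theorem for [h t * (x - x0) ^+ j.+1 - h x * (t - x0) ^+ j.+1], which
   vanishes at both [x0] and [x], whatever their order. *)
Lemma derive_on_growth (R : realType) (a b : R) (h : R -> R) (x0 C : R)
    (j : nat) :
  (forall x, x \in `[a, b] -> cvg (diff_quotient_on a b h x)) ->
  x0 \in `[a, b] -> h x0 = 0 ->
  (forall t, t \in `[a, b] -> `|derive_on a b h t| <= C * `|t - x0| ^+ j) ->
  forall x, x \in `[a, b] -> `|h x| <= C / j.+1%:R * `|x - x0| ^+ j.+1.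
Proof.
move=> hab x0ab hx0 hC x xab.
have [->|xx0] := eqVneq x x0.
  by rewrite hx0 subrr !normr0 expr0n mulr0.
pose phi : R -> R :=
  (x - x0) ^+ j.+1 *: h - h x *: ((id - cst x0) : R -> R) ^+ j.+1.
have phiE t : phi t = (x - x0) ^+ j.+1 * h t - h x * (t - x0) ^+ j.+1.
  by rewrite /phi !fctE.
pose u := Num.min x x0; pose v := Num.max x x0.
have uv : u < v by rewrite /u /v; case: (ltgtP x x0) xx0.
have [au vb] : a <= u /\ v <= b.
  move: xab x0ab; rewrite !in_itv/= /u /v le_min ge_max.
  by move=> /andP[-> ->] /andP[-> ->].
have phiuv : phi u = phi v.
  have p0 : phi x0 = phi x by rewrite !phiE hx0 subrr expr0n !mulr0 mulrC !subrr.
  by rewrite /u /v; case: (ltgtP x x0).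
have phiD t : t \in `]a, b[ -> is_derive t 1 phi
    ((x - x0) ^+ j.+1 * derive_on a b h t - h x * (j.+1%:R * (t - x0) ^+ j)).
  move=> tab; have dh : is_derive t 1 h (derive_on a b h t).
    apply: is_derive_interior => //; apply: hab.
    exact: subset_itv_oo_cc tab.
  apply: is_derive_eq.
  by rewrite !fctE/= subr0 /GRing.scale/= mulr1.
have sub t : t \in `]u, v[ -> t \in `]a, b[.
  rewrite !in_itv/= => /andP[ut tv]; apply/andP; split; lra.
(* [u] may be [a] and [v] may be [b], where [phiD] says nothing; continuity of [h] there comes from
   its one-sided quotients. *)
have phic : {within `[u, v], continuous phi}.
  apply: within_continuousB.
    apply: (@within_continuous_comp _ _ _ _ h ( *%R ((x - x0) ^+ j.+1))).
      by move=> y _; apply: cvgM; [exact: cvg_cst|exact: cvg_id].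
    apply: continuous_subspaceW (within_continuous_diff_quotient hab).
    by move=> y /=; rewrite !in_itv/= => /andP[uy yv]; apply/andP; split; lra.
  apply: derivable_within_continuous => y _.
  exact: ex_derive.
have phid t : t \in `]u, v[ -> derivable phi t 1.
  by move=> /sub/phiD dphi; exact: ex_derive.
have [c cuv dc] := Rolle uv phid phic phiuv.
have /esym/eqP := @derive_val _ _ _ _ _ _ _ dc.
have cab := sub c cuv.
rewrite (@derive_val _ _ _ _ _ _ _ (phiD c cab)) eq_sym subr_eq0 => /eqP E.
(* [c] lies strictly between [x0] and [x], so this factor can be cancelled from [E] once [hC] is
   applied at [c]. *)
have cx0 : 0 < `|c - x0| ^+ j.
  rewrite exprn_gt0// normr_gt0 subr_eq0; apply: contraTneq cuv => ->.
  by rewrite in_itv/= /u /v; case: (ltgtP x x0) xx0; rewrite ?ltxx ?andbF.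
have /(congr1 Num.norm) := E; rewrite !normrM !normrX normr_nat => {}E.
rewrite mulrAC ler_pdivlMr ?ltr0n// -(ler_pM2r cx0) -mulrA -E.
rewrite [leLHS]mulrC [leRHS]mulrAC ler_wpM2r// ?exprn_ge0//.
apply: hC; exact: subset_itv_oo_cc cab.
Qed.

(** Taylor's estimate with zero Taylor polynomial. Going down from the [m]-th derivative to [f],
    each use of [derive_on_growth] gains one power of [|x - x0|] and one factor of the factorial;
    [j] counts these uses. *)
Lemma nderive_on_bound (R : realType) (a b : R) (f : R -> R) (x0 M : R)
    (m : nat) :
  smooth_on a b f -> x0 \in `[a, b] -> vanishes_infinite_order a b f x0 ->
  (forall t, t \in `[a, b] -> `|nderive_on a b m f t| <= M) ->
  forall x, x \in `[a, b] -> `|f x| <= M / m`!%:R * `|x - x0| ^+ m.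
Proof.
move=> fs x0ab f0 fM.
suff H j k : (j + k = m)%N -> forall x, x \in `[a, b] ->
    `|nderive_on a b k f x| <= M / j`!%:R * `|x - x0| ^+ j.
  exact: H (addn0 m).
elim: j k => [|j IH] k jk x xab.
  by rewrite -jk add0n in fM; rewrite fact0 divr1 expr0 mulr1 fM.
rewrite factS mulnC natrM invfM mulrA.
apply: (derive_on_growth (fs k)) => //.
by move=> t tab; apply: (IH k.+1) => //; rewrite addnS.
Qed.

(** For [n > 0], [n ^ n / n!] is one of the nonnegative terms of the exponential series at [n]. *)
Lemma exprn_le_fact (R : realType) (n : nat) :
  n%:R ^+ n <= (expR 1 : R) ^+ n * n`!%:R.
Proof.
case: n => [|n]; first by rewrite !expr0 fact0 mulr1.
rewrite -expRM_natl mulr1 -ler_pdivrMr ?ltr0n ?fact_gt0//.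
by rewrite (le_trans _ (expR_ge1Dxn n (ler0n _ _)))// lerDr.
Qed.

Lemma zero_near_vanishing_point (R : realType) (a b : R) (f : R -> R)
    (d : nat -> nat) (K x0 : R) :
  smooth_on a b f -> d n @[n --> \oo] --> \oo -> 0 < K ->
  (forall n x, x \in `[a, b] ->
    `|nderive_on a b (d n) f x| <= K ^+ (d n).+1 * (d n)%:R ^+ (d n)) ->
  x0 \in `[a, b] -> vanishes_infinite_order a b f x0 ->
  forall x, x \in `[a, b] -> `|x - x0| < (K * expR 1)^-1 -> f x = 0.
Proof.
move=> fs doo K0 fK x0ab f0 x xab xr.
pose q := K * expR 1 * `|x - x0|.
have Ke0 : 0 < K * expR 1 by rewrite mulr_gt0 ?expR_gt0.
have q0 : 0 <= q by rewrite mulr_ge0 ?(ltW Ke0).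
have q1 : q < 1 by rewrite /q mulrC -ltr_pdivlMr// div1r.
have fq n : `|f x| <= K * q ^+ d n.
  apply: le_trans (nderive_on_bound fs x0ab f0 (fK n) xab) _.
  rewrite /q !exprMn exprS -!mulrA ler_pM2l// ler_wpM2l ?exprn_ge0 ?(ltW K0)//.
  rewrite mulrA ler_wpM2r ?exprn_ge0// ler_pdivrMr ?ltr0n ?fact_gt0//.
  exact: exprn_le_fact.
(* Divergence of [d] enters here: the powers of [q < 1] are taken along [d]. *)
have q_cvg : K * q ^+ d n @[n --> \oo] --> K * 0.
  apply: cvgM; [exact: cvg_cst|apply: (cvg_comp d (fun m => q ^+ m)) doo _;
    by apply: cvg_expr; rewrite ger0_norm].
apply/eqP; rewrite -normr_le0 -(mulr0 K).
apply: (@ler_cvg_to _ _ _ _ (fun=> `|f x|) _ _ _ (cvg_cst _) q_cvg).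
exact: nearW.
Qed.

(** Induction on the order, for all points of the ball at once: a derivative that is zero on a
    relatively open set has zero derivative there. *)
Lemma vanishing_propagates (R : realType) (a b : R) (f : R -> R) (r x0 : R) :
  a < b ->
  (forall y x, y \in `[a, b] -> vanishes_infinite_order a b f y ->
    x \in `[a, b] -> `|x - y| < r -> f x = 0) ->
  x0 \in `[a, b] -> vanishes_infinite_order a b f x0 ->
  forall x, x \in `[a, b] -> `|x - x0| < r -> vanishes_infinite_order a b f x.
Proof.
move=> ab fr x0ab f0 x xab xr n; elim: n x xab xr => [|n IH] x xab xr.
  exact: (fr x0).
(* The ball of this radius around [x] lies in the ball of radius [r] around [x0]. *)
apply: (@derive_on_locally0 _ _ _ _ _ (r - `|x - x0|)) => //.
  by rewrite subr_gt0.
move=> y yab xy; apply: IH => //.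
by have := ler_distD x y x0; rewrite (distrC y x); lra.
Qed.

Theorem proposition1 (R : realType) (a b : R) (hab : a < b)
    (f : R -> R) (hf : smooth_on a b f)
    (F : nat -> R)
    (hF : forall n, is_max [set `|nderive_on a b n f x| | x in `[a, b]] (F n))
    (d : nat -> nat) (hd_pos : forall n, (0 < d n)%N)
    (hd_incr : nondecreasing_seq d) (hd_div : d n @[n --> \oo] --> \oo)
    (hK : exists2 K : R, 0 < K &
          forall n, F (d n) <= K ^+ (d n).+1 * (d n)%:R ^+ (d n)) :
  (exists2 x0, x0 \in `[a, b] & vanishes_infinite_order a b f x0) ->
  forall x, x \in `[a, b] -> f x = 0.
Proof.
case: hK => K K0 FK [x0 x0ab f0] x xab.
have fK n y : y \in `[a, b] ->
    `|nderive_on a b (d n) f y| <= K ^+ (d n).+1 * (d n)%:R ^+ (d n).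
  by move=> yab; apply: le_trans (FK n); apply: (hF (d n)).2; exists y.
pose r := (K * expR 1)^-1.
have r0 : 0 < r by rewrite invr_gt0 mulr_gt0 ?expR_gt0.
have fr y z : y \in `[a, b] -> vanishes_infinite_order a b f y ->
    z \in `[a, b] -> `|z - y| < r -> f z = 0.
  by move=> yab fy; exact: (zero_near_vanishing_point hf hd_div K0 fK yab fy).
(* After [n] steps of length less than [r], vanishing of infinite order has reached distance
   [n * r]; some [n] reaches [x], and order 0 gives [f x = 0]. *)
suff H (n : nat) z : z \in `[a, b] -> `|z - x0| < n%:R * r ->
    vanishes_infinite_order a b f z.
  apply: (H (Num.bound (`|x - x0| / r)) x xab _ 0%N).
  rewrite -ltr_pdivrMr//; apply: archi_boundP.
  by rewrite divr_ge0 ?(ltW r0).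
elim: n z => [|n IH] z zab zn.
  by move: zn; rewrite mul0r ltNge normr_ge0.
(* The point [y] below divides the segment from [x0] to [z] in the ratio [n : 1], so
   [|y - x0| < n * r] when [n > 0], and [|z - y| < r]. *)
pose t : R := n%:R / n.+1%:R.
have n1 : 0 < n.+1%:R :> R by rewrite ltr0n.
have t0 : 0 <= t by rewrite divr_ge0.
have t1 : 1 - t = n.+1%:R^-1.
  by rewrite /t -[X in X - _](divff (lt0r_neq0 n1)) -mulrBl -natrB//
    subSnn div1r.
have t1' : 0 < 1 - t by rewrite t1 invr_gt0.
have {}zn : `|z - x0| / n.+1%:R < r by rewrite ltr_pdivrMr// mulrC.
pose y := x0 + t * (z - x0).
have yab : y \in `[a, b].
  move: zab x0ab; rewrite !in_itv/= /y => /andP[az zb] /andP[ax xb].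
  by apply/andP; split; nra.
(* For [n = 0] the induction hypothesis concerns an empty ball, so the first step starts from [x0]
   itself. *)
have [n0|n0] := posnP n.
  apply: (vanishing_propagates hab fr x0ab f0 zab).
  by move: zn; rewrite n0 divr1.
apply: (vanishing_propagates hab fr yab _ zab).
  apply: IH => //.
  rewrite /y addrAC subrr add0r normrM (ger0_norm t0) /t -mulrA ltr_pM2l ?ltr0n//.
  by rewrite mulrC.
rewrite (_ : z - y = (1 - t) * (z - x0)); last by rewrite /y; lra.
by rewrite normrM gtr0_norm// t1 mulrC.
Qed.
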